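(* Let $X$ be a well-ordered set and $\Omega$ a nonempty well-ordered set disjoint from $X$, and let $(\lambda_\omega)_{\omega\in\Omega}$ be a family of elements of $\mathbf{k}$. With the order $\leq_{\mathrm{db}}$ on $\mathfrak{M}(X,\Omega)$, the set $$S=\left\{\lfloor x\rfloor_\alpha\lfloor y\rfloor_\beta-\lfloor x\lfloor y\rfloor_\beta\rfloor_\alpha-\lfloor\lfloor x\rfloor_\alpha y\rfloor_\beta-\lambda_\beta\lfloor xy\rfloor_\alpha\ \middle|\ x,y\in\mathfrak{M}(X,\Omega),\ \alpha,\beta\in\Omega\right\}$$ is a Gröbner-Shirshov basis in $\mathbf{k}\mathfrak{M}(X,\Omega)$.
   Context: $\mathbf{k}$ is a fixed unitary commutative ring. Bracketed words: for a set $Y$ and $\omega\in\Omega$, $\lfloor Y\rfloor_\omega=\{\lfloor y\rfloor_\omega\mid y\in Y\}$ is a copy of $Y$, disjoint from $Y$ and from the copies for other $\omega$. With $M(\cdot)$ the free monoid, $\mathfrak{M}_0:=M(X)$, $\mathfrak{M}_{n+1}:=M\big(X\sqcup\bigsqcup_{\omega\in\Omega}\lfloor\mathfrak{M}_n\rfloor_\omega\big)$, $\mathfrak{M}(X,\Omega):=\bigcup_n\mathfrak{M}_n$ (also written $\mathfrak{M}(\Omega,X)$), and $P_\omega(u):=\lfloor u\rfloor_\omega$. The depth $\mathrm{dep}(u)$ is the least $n$ with $u\in\mathfrak{M}_n$. Every $u\ne1$ factors uniquely as $u=w_1\cdots w_k$ with each $w_i\in X$ or $w_i=\lfloor v\rfloor_\omega$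 for some $v\in\mathfrak{M}(X,\Omega)$, $\omega\in\Omega$; the breadth is $|u|:=k$, and $|1|:=0$. Order $\leq_{\mathrm{db}}$: on $M(X)$ use the degree lexicographical order extending the order of $X$ (compare lengths first, then lexicographically; $1$ is least). Every $u\in\mathfrak{M}(X,\Omega)$ is uniquely $u=u_0P_{\alpha_1}(u_1^* )u_1P_{\alpha_2}(u_2^* )u_2\cdots P_{\alpha_r}(u_r^* )u_r$ with $u_i\in M(X)$, $u_i^*\in\mathfrak{M}(X,\Omega)$, $\alpha_i\in\Omega$; set $\mathrm{bre}_P(u):=r$, and let $\deg_P(u)$ be the total number of occurrences of brackets $\lfloor\ \rfloor_\omega$, $\omega\in\Omega$, in $u$. For $u,v\in\mathfrak{M}(X,\Omega)$ written uniquely in this form as $u=u_0P_{\alpha_1}(u_1^* )u_1\cdots P_{\alpha_r}(u_r^* )u_r$ and $v=v_0P_{\beta_1}(v_1^* )v_1\cdots P_{\beta_s}(v_s^* )v_s$ (with $u_i,v_i\in M(X)$, $u_i^*,v_i^*\in\mathfrak{M}(X,\Omega)$, $\alpha_i,\beta_i\in\Omega$), define $u\leq_{\mathrm{db}}v$ by induction on $\mathrm{dep}(u)+\mathrm{dep}(v)$: if this sum is $0$ use the order on $M(X)$; otherwise $u\leq_{\mathrm{db}}v$ iff $\deg_P(u)<\deg_P(v)$; or $\deg_P(u)=\deg_P(v)$ and $\mathrm{bre}_P(u)<\mathrm{bre}_P(v)$; or $\deg_P(u)=\deg_P(v)$, $\mathrm{bre}_P(u)=\mathrm{bre}_P(v)=r$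 and $(P_{\alpha_1},u_1^*,\ldots,P_{\alpha_r},u_r^*,u_0,\ldots,u_r)\le(P_{\beta_1},v_1^*,\ldots,P_{\beta_r},v_r^*,v_0,\ldots,v_r)$ lexicographically, where $P_{\alpha_i}$ and $P_{\beta_i}$ are compared by the order on $\Omega$ and the other entries by the induction hypothesis. This is a monomial order: a well order with $u<v\Rightarrow q|_u<q|_v$ for all bracketed words $q$ on $X\sqcup\{\star\}$ (where $\star\notin X$) with exactly one occurrence of $\star$, $q|_u$ denoting the result of replacing $\star$ by $u$ in $q$. Gröbner-Shirshov bases: let $\star\notin X$. $\mathfrak{M}(X,\Omega)^\star$ is the set of bracketed words on $X\sqcup\{\star\}$ with exactly one occurrence of $\star$; for $q$ in it, $q|_u$ is obtained by replacing $\star$ by $u$, and $q|_s:=\sum_ic_iq|_{u_i}$ for $s=\sum_ic_iu_i\in\mathbf{k}\mathfrak{M}(X,\Omega)$. For $f\in\mathbf{k}\mathfrak{M}(X,\Omega)\setminus\mathbf{k}$, $\bar f$ is the largest bracketed word appearing in $f$; $f$ is monic if the coefficient of $\bar f$ is $1$; a set is monic if all its elements are. Let $f,g$ be monic. (1) If there are $u,v,w\in\mathfrak{M}(X,\Omega)$ with $w=\bar fu=v\bar g$ and $\max\{|\bar f|,|\bar g|\}<|w|<|\bar f|+|\bar g|$, then $(f,g)_w:=fu-vg$ is an intersection composition of $f$ and $g$. (2) If there are $q\in\mathfrak{M}(X,\Omega)^\star$ and $w\in\mathfrak{M}(X,\Omega)$ with $w=\bar f=q|_{\bar g}$, then $(f,g)_w:=f-q|_g$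 is an including composition of $f$ and $g$. For a monic set $S$, an element is trivial modulo $(S,w)$ if it is a linear combination $\sum_ic_iq_i|_{s_i}$ with $0\ne c_i\in\mathbf{k}$, $q_i\in\mathfrak{M}(X,\Omega)^\star$, $s_i\in S$ and $q_i|_{\overline{s_i}}<w$. A monic set $S$ is a Gröbner-Shirshov basis (with respect to the given monomial order) if for each pair $f,g\in S$ with $f\ne g$, every intersection composition and every including composition $(f,g)_w$ is trivial modulo $(S,w)$. *)

(* Defs.v *)
From HB Require Import structures.
From mathcomp Require Import all_boot all_order all_algebra.
From mathcomp Require Import finmap monalg.

Set Implicit Arguments.
Unset Strict Implicit.
Unset Printing Implicit Defensive.

Import Order.TTheory GRing.Theory.

Local Open Scope ring_scope.

(* The indecomposable factors: X together with the disjoint copies of the set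
   of bracketed words, one for each element of Omega.  Since words are finite
   sequences of such letters, concatenation is the monoid law, [::] is the
   unit word 1 and [size] is the breadth. *)
Inductive letter (X Omega : Type) : Type :=
  | Gen of X
  | Brk of Omega & seq (letter X Omega).

Arguments Gen {X Omega} _.
Arguments Brk {X Omega} _ _.

Definition bword (X Omega : Type) : Type := seq (letter X Omega).

Definition brk {X Omega : Type} (a : Omega) (u : bword X Omega) :
  bword X Omega := [:: Brk a u].

Section LetterInd.
Variables (X Omega : Type) (P : letter X Omega -> Prop).
Hypothesis PGen : forall x, P (Gen x).
Hypothesis PBrk : forall a u, foldr (fun l Q => P l /\ Q) True u -> P (Brk a u).

Fixpoint letter_nested_ind (l : letter X Omega) : P l :=
  match l with
  | Gen x => PGen x
  | Brk a u => PBrk a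
      ((fix loop (s : seq (letter X Omega)) :
          foldr (fun l Q => P l /\ Q) True s :=
        match s with
        | [::] => I
        | l' :: s' => conj (letter_nested_ind l') (loop s')
        end) u)
  end.
End LetterInd.

Section LetterChoice.
Variables X Omega : choiceType.

Fixpoint letter_encode (l : letter X Omega) : GenTree.tree (X + Omega) :=
  match l with
  | Gen x => GenTree.Leaf (inl x)
  | Brk a u => GenTree.Node 0 (GenTree.Leaf (inr a) :: map letter_encode u)
  end.

Fixpoint letter_decode (t : GenTree.tree (X + Omega)) :
    option (letter X Omega) :=
  match t with
  | GenTree.Leaf (inl x) => Some (Gen x)
  | GenTree.Node _ (GenTree.Leaf (inr a) :: ts) =>
      Some (Brk a (pmap letter_decode ts))
  | _ => None
  end.

Lemma letter_encodeK : pcancel letter_encode letter_decode.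
Proof.
elim/letter_nested_ind => // a u IHu /=; congr (Some (Brk a _)).
by elim: u IHu => //= l u IH [-> /IH ->].
Qed.

(* Opaque, so that failing conversion tests on monomials do not unfold them *)
Fact letter_hasDecEq : hasDecEq (letter X Omega).
Proof.
exact (hasDecEq.Build (letter X Omega) (inj_eqAxiom (pcan_inj letter_encodeK))).
Qed.

HB.instance Definition _ := letter_hasDecEq.

Fact letter_hasChoice : hasChoice (letter X Omega).
Proof. exact: PCanHasChoice letter_encodeK. Qed.

HB.instance Definition _ := letter_hasChoice.
HB.instance Definition _ := Choice.copy (bword X Omega) (seq (letter X Omega)).

Lemma bword_unitm (u v : bword X Omega) :
  u ++ v = [::] -> u = [::] /\ v = [::].
Proof. by case: u. Qed.

HB.instance Definition _ := Choice_isMonomialDef.Build (bword X Omega)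
  (@catA (letter X Omega)) (@cat0s (letter X Omega)) (@cats0 (letter X Omega))
  bword_unitm.
End LetterChoice.

(* Concatenation of bracketed words, typed through the monoid instance of
   [bword] (and not through that of [seq]) so that the instances used in the
   monoid algebra agree. *)
Notation "u * v" := (mmul u v) : monom_scope.

Section Depth.
Variables X Omega : Type.
Implicit Types (l : letter X Omega) (u : bword X Omega).

Fixpoint in_stage_letter (n : nat) l {struct l} : bool :=
  match l, n with
  | Gen _, _ => true
  | Brk _ v, n'.+1 => all (in_stage_letter n') v
  | Brk _ _, 0%N => false
  end.

(* u belongs to the n-th stage of the construction of bracketed words *)
Definition in_stage (n : nat) u : bool := all (in_stage_letter n) u.

Fixpoint dep_letter l : nat :=
  match l with
  | Gen _ => 0
  | Brk _ v => (foldr maxn 0 (map dep_letter v)).+1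
  end.

Definition dep u : nat := foldr maxn 0%N (map dep_letter u).

Lemma dep_leE u n : (dep u <= n)%N = in_stage n u.
Proof.
have seqP (P : letter X Omega -> Prop) (s : bword X Omega) :
  (forall l, P l) -> foldr (fun l Q => P l /\ Q) True s.
  by move=> PA; elim: s => //= l s IH; split.
have key m (s : bword X Omega) :
    foldr (fun l Q => (forall n', (dep_letter l <= n')%N = in_stage_letter n' l)
                      /\ Q) True s ->
    (foldr maxn 0 (map dep_letter s) <= m)%N = all (in_stage_letter m) s.
  by elim: s => //= l s IH [Hl /IH Hs]; rewrite geq_max Hl Hs.
rewrite /dep key //; apply: seqP.
elim/letter_nested_ind => //= a v IHv [|m] //=.
by rewrite ltnS key.
Qed.

Fixpoint degP_letter l : nat :=
  match l with
  | Gen _ => 0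
  | Brk _ v => (sumn (map degP_letter v)).+1
  end.

Definition degP u : nat := sumn (map degP_letter u).

(* (u_0, [:: (alpha_1, u_1^*, u_1); ...; (alpha_r, u_r^*, u_r)]), where
   u = u_0 P_{alpha_1}(u_1^* ) u_1 ... P_{alpha_r}(u_r^* ) u_r *)
Fixpoint blocks u : seq X * seq (Omega * bword X Omega * seq X) :=
  match u with
  | [::] => ([::], [::])
  | Gen x :: u' => (x :: (blocks u').1, (blocks u').2)
  | Brk a v :: u' => ([::], (a, v, (blocks u').1) :: (blocks u').2)
  end.

Definition breP u : nat := size (blocks u).2.

Definition word_of (s : seq X) : bword X Omega := map Gen s.

Lemma blocksK u :
  u = word_of (blocks u).1
      ++ flatten [seq brk b.1.1 b.1.2 ++ word_of b.2 | b <- (blocks u).2].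
Proof. by elim: u => //= -[x|a v] u {1}->. Qed.

(* The tuple (P_{alpha_1}, u_1^*, ..., P_{alpha_r}, u_r^*, u_0, ..., u_r) *)
Definition db_key u : seq (Omega + bword X Omega) :=
  flatten [seq [:: inl b.1.1; inr b.1.2] | b <- (blocks u).2]
  ++ [seq inr (word_of s) | s <- (blocks u).1 :: [seq b.2 | b <- (blocks u).2]].

End Depth.

Arguments word_of {X Omega} s.

(* Non-strict lexicographic comparison with respect to the order [le]; it is
   only used on sequences of the same length. *)
Fixpoint lex_le (T : eqType) (le : rel T) (s t : seq T) : bool :=
  match s, t with
  | [::], _ => true
  | _ :: _, [::] => false
  | x :: s', y :: t' => if x == y then lex_le le s' t' else le x y
  end.

Definition deglex_le dX (X : orderType dX) (s t : seq X) : bool :=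
  (size s < size t)%N || (size s == size t) && lex_le <=%O s t.

Section DbOrder.
Context {dX dO : Order.disp_t} {X : orderType dX} {Omega : orderType dO}.
Implicit Types u v : bword X Omega.

Definition entry_le (le : rel (bword X Omega)) (e f : Omega + bword X Omega) :
  bool :=
  match e, f with
  | inl a, inl b => (a <= b)%O
  | inr u, inr v => le u v
  | _, _ => false
  end.

(* One step of the recursive definition; [le] stands for the order already
   defined on pairs of words with a smaller sum of depths. *)
Definition db_step (le : rel (bword X Omega)) u v : bool :=
  [|| (degP u < degP v)%N,
      (degP u == degP v) && (breP u < breP v)%N
    | [&& degP u == degP v, breP u == breP v
        & lex_le (entry_le le) (db_key u) (db_key v)]].

(* [n] is the sum of the depths on which the induction is done.  When it is 0,
   u and v lie in M(X), hence are equal to their first blocks. *)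
Fixpoint db_le_rec (n : nat) u v : bool :=
  if n is n'.+1 then db_step (db_le_rec n') u v
  else deglex_le (blocks u).1 (blocks v).1.

Definition db_le u v : bool := db_le_rec (dep u + dep v) u v.

Lemma dep_word_of (s : seq X) : dep (word_of s : bword X Omega) = 0%N.
Proof. by rewrite /dep; elim: s => //= x s ->. Qed.

Lemma dep_cons l u : dep (l :: u) = maxn (dep_letter l) (dep u).
Proof. by []. Qed.

Lemma db_step_eq le1 le2 u v :
  (forall u' v', (dep u' + dep v' <= (dep u + dep v).-1)%N ->
     le1 u' v' = le2 u' v') ->
  db_step le1 u v = db_step le2 u v.
Proof.
move=> le12.
have key_dep (w : bword X Omega) e : e \in db_key w ->
    if e is inr w' then (dep w' <= (dep w).-1)%N else true.
  rewrite mem_cat => /orP[/flatten_mapP[b + eb]|/mapP[s _ ->]]; last first.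
    by rewrite /= dep_word_of.
  move: eb; rewrite !inE => /orP[]/eqP-> // bw.
  suff: (dep b.1.2 < dep w)%N by case: (dep w).
  elim: w bw => //= -[x|a w'] w IH /= bw; rewrite dep_cons leq_max.
    by rewrite IH // orbT.
  by move: bw; rewrite inE => /orP[/eqP-> /=|/IH ->]; rewrite ?orbT ?ltnSn.
suff lex_eq (s t : seq (Omega + bword X Omega)) :
    {in s & t, forall e f, entry_le le1 e f = entry_le le2 e f} ->
    lex_le (entry_le le1) s t = lex_le (entry_le le2) s t.
  rewrite /db_step (lex_eq (db_key u)) // => -[a|u'] [b|v'] //=.
  move=> /key_dep du /key_dep dv; apply: le12.
  by have := leq_add du dv; case: (dep u) (dep v) => [|d1] [|d2] //= h;
    rewrite ?addnS ?addSn; apply: leqW.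
elim: s t => [|e s IH] [|f t] //= eq12.
rewrite (eq12 e f) ?mem_head // IH // => e' f' e's f't.
by rewrite eq12 // inE ?e's ?f't orbT.
Qed.

Lemma db_le_rec_fuel n u v : (dep u + dep v <= n)%N ->
  db_le_rec n u v = db_le u v.
Proof.
have deglex_refl (s : seq X) : deglex_le s s.
  by rewrite /deglex_le eqxx orbC /=; elim: s => //= x s; rewrite eqxx.
have word_depth0 (w : bword X Omega) : dep w = 0%N -> w = word_of (blocks w).1.
  elim: w => //= -[x|a w'] w IH; rewrite dep_cons /=.
    by rewrite max0n => /IH {1}->.
  by move/eqP; rewrite -leqn0 geq_max.
have blocks_word (s : seq X) : blocks (word_of s : bword X Omega) = (s, [::]).
  by elim: s => //= x s ->.
have degP_word (s : seq X) : degP (word_of s : bword X Omega) = 0%N.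
  by rewrite /degP; elim: s.
have base p (s t : seq X) :
    db_le_rec p (word_of s) (word_of t : bword X Omega) = deglex_le s t.
  elim: p => [|p IH] /=; first by rewrite !blocks_word.
  rewrite /db_step !degP_word /breP /db_key !blocks_word /= IH.
  case: eqP => [[/inj_map st]|_]; last by case: deglex_le.
  by rewrite st ?deglex_refl // => x y [].
have base0 p (w1 w2 : bword X Omega) :
    (dep w1 + dep w2)%N = 0%N ->
    db_le_rec p w1 w2 = deglex_le (blocks w1).1 (blocks w2).1.
  move=> /eqP; rewrite addn_eq0 => /andP[/eqP/word_depth0 d1 /eqP/word_depth0 d2].
  by rewrite {1}d1 {1}d2 base.
rewrite /db_le; elim/ltn_ind: n u v => -[|n] IH u v len.
  by move: len; rewrite leqn0 => /eqP ->.
case D: (dep u + dep v)%N len => [|d] len; first by rewrite !base0.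
apply: db_step_eq => u' v'; rewrite D /= => ltd.
rewrite -!/(db_le_rec _ _ _) (IH n) ?(IH d) //; exact: leq_trans ltd _.
Qed.

(* The recursive definition of the order, freed from its recursion bound *)
Lemma db_leE u v :
  db_le u v = if (dep u + dep v == 0)%N then deglex_le (blocks u).1 (blocks v).1
              else db_step db_le u v.
Proof.
rewrite {1}/db_le; case D: (dep u + dep v)%N => [|d] //=.
by apply: db_step_eq => u' v'; rewrite D => /db_le_rec_fuel.
Qed.

End DbOrder.

Section StarWords.
Variables X Omega : choiceType.

(* [None] plays the role of the symbol star. *)
Fixpoint nstar_letter (l : letter (option X) Omega) : nat :=
  match l with
  | Gen None => 1
  | Gen (Some _) => 0
  | Brk _ v => sumn (map nstar_letter v)
  end.

Definition nstar (q : bword (option X) Omega) : nat :=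
  sumn (map nstar_letter q).

Definition star_word : Type := {q : bword (option X) Omega | nstar q == 1%N}.

Fixpoint subst_letter (u : bword X Omega) (l : letter (option X) Omega) :
    bword X Omega :=
  match l with
  | Gen None => u
  | Gen (Some x) => [:: Gen x]
  | Brk a v => brk a (flatten (map (subst_letter u) v))
  end.

Definition subst (q : star_word) (u : bword X Omega) : bword X Omega :=
  flatten (map (subst_letter u) (val q)).

Definition lsubst (k : comNzRingType) (q : star_word)
    (s : {malg k[bword X Omega]}) : {malg k[bword X Omega]} :=
  \sum_(u <- msupp s) s@_u *: << subst q u >>.
End StarWords.

Section GroebnerShirshov.
Context {k : comNzRingType} {X Omega : choiceType}.
Variable le : rel (bword X Omega).

Local Notation A := {malg k[bword X Omega]}.
Implicit Types (f g h : A) (w : bword X Omega) (S : A -> Prop).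

(* w is the leading word of f, which is only defined when f is not in k. *)
Definition leading f w : Prop :=
  [/\ ~ (exists c : k, f = c%:MP), w \in msupp f
    & {in msupp f, forall u, le u w}].

Definition gs_monic f : Prop := exists2 w, leading f w & f@_w = 1.

Definition intersection_composition f g w h : Prop :=
  exists wf wg (u v : bword X Omega),
    [/\ leading f wf, leading g wg, w = (wf * u)%M /\ w = (v * wg)%M,
        (maxn (size wf) (size wg) < size w < size wf + size wg)%N
      & h = f * << u >> - << v >> * g].

Definition including_composition f g w h : Prop :=
  exists wf wg (q : star_word X Omega),
    [/\ leading f wf, leading g wg, w = wf /\ w = subst q wg
      & h = f - lsubst q g].

Definition trivial_modulo S w h : Prop :=
  exists n (c : 'I_n -> k) (q : 'I_n -> star_word X Omega) (s : 'I_n -> A),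
    (forall i, [/\ c i != 0, S (s i)
       & exists2 ws, leading (s i) ws
                   & (subst (q i) ws != w) && le (subst (q i) ws) w])
    /\ h = \sum_(i < n) c i *: lsubst (q i) (s i).

Definition groebner_shirshov_basis S : Prop :=
  (forall f, S f -> gs_monic f)
  /\ forall f g, S f -> S g -> f <> g -> forall w h,
       intersection_composition f g w h \/ including_composition f g w h ->
       trivial_modulo S w h.

End GroebnerShirshov.

Definition matching_rota_baxter_set (k : comNzRingType) (X Omega : choiceType)
    (lambda : Omega -> k) (f : {malg k[bword X Omega]}) : Prop :=
  exists (x y : bword X Omega) (a b : Omega),
    f = << (brk a x * brk b y)%M >> - << brk a (x * brk b y)%M >>
        - << brk b (brk a x * y)%M >> - lambda b *: << brk a (x * y)%M >>.

(* Main.v *)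
Require Import Defs.
From mathcomp Require Import all_boot all_order all_algebra.
From mathcomp Require Import finmap monalg.
From mathcomp Require Import zify ring.

(** Write [x]_a for the bracket of x by the operator a.  The leading word of
    the element with parameters x, a, y, b is [x]_a [y]_b: [xy]_a has
    fewer brackets, while [x [y]_b]_a and [[x]_a y]_b have as many brackets but
    only one of them outermost.  So the pair (degP, breP), called the weight
    below, already decides these comparisons ([weight_rb]).

    Two leading words can meet in three ways.

    - They overlap in [x]_a [y]_b [z]_c.  Rewriting each product of two
      brackets that remains in the composition, the result is the Rota-Baxter
      element of y, z placed inside [x _]_a and that of x, y placed inside
      [_ z]_c; everything else cancels ([intersection_trivial]).
    - The second leading word m sits inside x = q|_m.  Replacing m by the
      smaller words m_i of the second element g, the composition becomes a
      combination of the elements with parameters q|_(m_i), a, y, b and of g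
      placed in [q [y]_b]_a, [[q]_a y]_b and [q y]_a
      ([including_left_trivial]).
    - It sits inside y, which is symmetric ([including_right_trivial]).

    There is no other inclusion, because a word of breadth two inside a
    word of breadth two is all of it or lies inside a bracket
    ([subst_eq_brk_brk]), and in the first case the two elements agree.

    All comparisons with the ambiguity w follow from the weight, except that
    [q|_(m_i)]_a [y]_b < [q|_m]_a [y]_b needs monotonicity of the order in the
    context q ([db_lt_subst]).  Here m_i is below m in weight.  At the place of
    the star the weight decides, and each bracket around it preserves strict
    inequality, since the keys of the two bracketed words then differ in one
    entry only ([db_lt_brk]).

    Each equation between a composition and its combination is compared
    coefficient by coefficient, that is after applying functionals phi, where
    it becomes an identity between scalars with the values of phi as
    unknowns. *)

Set Implicit Arguments.
Unset Strict Implicit.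
Unset Printing Implicit Defensive.

Import Order.TTheory GRing.Theory.

Local Open Scope ring_scope.

(** * Degree and breadth of bracketed words *)

Section Weight.
Context {X Omega : Type}.
Implicit Types u v p : bword X Omega.

Lemma degP_cat u v : degP (u ++ v) = (degP u + degP v)%N.
Proof. by rewrite /degP map_cat sumn_cat. Qed.

Lemma degP_brk (a : Omega) u : degP (brk a u) = (degP u).+1.
Proof. by rewrite /degP /= addn0. Qed.

Lemma breP_cat u v : breP (u ++ v) = (breP u + breP v)%N.
Proof. by rewrite /breP; elim: u => //= -[x|a w] u /= ->. Qed.

Lemma breP_brk (a : Omega) u : breP (brk a u) = 1%N.
Proof. by []. Qed.

Lemma dep0_weight u : dep u = 0%N -> degP u = 0%N /\ breP u = 0%N.
Proof.
elim: u => // l u IH; rewrite -[dep _]/(maxn (dep_letter l) (dep u)) => /eqP.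
rewrite -leqn0 geq_max !leqn0; case: l => [x|a w] //= /eqP/IH[d b].
by split; [rewrite -d | rewrite -b].
Qed.

(** The first two criteria of the order.  Unlike the whole order, they are
    visibly compatible with concatenation. *)
Definition weight_lt u v : bool :=
  (degP u < degP v)%N || (degP u == degP v) && (breP u < breP v)%N.

Lemma weight_lt_cat p u v r :
  weight_lt u v -> weight_lt (p ++ u ++ r) (p ++ v ++ r).
Proof. by rewrite /weight_lt !degP_cat !breP_cat; lia. Qed.

Lemma blocks_cat_brk (a : Omega) p r : exists s L t R, forall u,
  blocks (p ++ brk a u ++ r) = (s, L ++ (a, u, t) :: R).
Proof.
elim: p => [|[x|b w] p [s [L [t [R E]]]]].
- by exists [::], [::], (blocks r).1, (blocks r).2.
- by exists (x :: s), L, t, R => u; rewrite /= E.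
- by exists [::], ((b, w, s) :: L), t, R => u; rewrite /= E.
Qed.

(** The content of an outermost bracket is a single entry of the key, and the
    rest of the key does not depend on it. *)
Lemma db_key_cat_brk (a : Omega) p r : exists A B, forall u,
  db_key (p ++ brk a u ++ r) = A ++ inr u :: B.
Proof.
have [s [L [t [R E]]]] := blocks_cat_brk a p r.
eexists (flatten [seq [:: inl c.1.1; inr c.1.2] | c <- L] ++ [:: inl a]), _ => u.
by rewrite /db_key E /= !map_cat flatten_cat /= -!catA; reflexivity.
Qed.

End Weight.

Lemma lex_le_cat (T : eqType) (le : rel T) (A B : seq T) (e f : T) :
  e != f -> le e f -> lex_le le (A ++ e :: B) (A ++ f :: B).
Proof. by move=> ne ef; elim: A => /= [|c A ->]; rewrite ?eqxx ?(negPf ne). Qed.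

(** * Monotonicity of the order *)

Section DbOrderTheory.
Context {dX dO : Order.disp_t} {X : orderType dX} {Omega : orderType dO}.
Implicit Types u v w p r : bword X Omega.

Definition db_lt u v : bool := (u != v) && db_le u v.

Lemma lex_le_refl (T : eqType) (le : rel T) (s : seq T) : lex_le le s s.
Proof. by elim: s => //= x s; rewrite eqxx. Qed.

Lemma db_le_refl u : db_le u u.
Proof.
rewrite db_leE /db_step /deglex_le !eqxx !lex_le_refl /= !orbT.
by case: ifP.
Qed.

Lemma db_le_weight u v : db_le u v -> ~~ weight_lt v u.
Proof.
rewrite db_leE /db_step /weight_lt addn_eq0; case: ifP => [/andP[]|_].
  by move=> /eqP/dep0_weight[-> ->] /eqP/dep0_weight[-> ->].
by case/or3P => [|/andP[]|/and3P[]]; lia.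
Qed.

Lemma db_lt_weight u v : weight_lt u v -> db_lt u v.
Proof.
move=> uv; rewrite /db_lt; apply/andP; split.
  by apply: contraTneq uv => ->; rewrite /weight_lt; lia.
rewrite db_leE /db_step addn_eq0; case: ifP => [/andP[_]|_].
  by move=> /eqP/dep0_weight; move: uv; rewrite /weight_lt; lia.
by case/orP: uv => [->|->] //; rewrite orbT.
Qed.

(** If the contents differ in degree, so do the whole words.  Otherwise the
    whole words agree in degree and in breadth, even when the contents differ
    in breadth, and the entry of the key that holds the content decides. *)
Lemma db_lt_brk (a : Omega) p r u v :
  db_lt u v -> db_lt (p ++ brk a u ++ r) (p ++ brk a v ++ r).
Proof.
case/andP => ne uv; have := db_le_weight uv.
rewrite /weight_lt negb_or => /andP[]; rewrite -leqNgt leq_eqVlt.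
case/orP => [/eqP d _|d _]; last first.
  by apply/db_lt_weight; rewrite /weight_lt !degP_cat !degP_brk; lia.
apply/andP; split.
  by apply: contra_neq ne => /eqP; rewrite eqseq_cat // eqxx => /eqP[].
have [A [B E]] := db_key_cat_brk a p r.
rewrite db_leE /db_step /breP; have [s [L [t [R Eb]]]] := blocks_cat_brk a p r.
case: ifP => [|_].
  rewrite addn_eq0 => /andP[/eqP/dep0_weight[d0 _] _]; move: d0.
  by rewrite (degP_cat p) (degP_cat (brk a u)) degP_brk; lia.
apply/or3P/Or33; rewrite !degP_cat !degP_brk !E !Eb !size_cat d !eqxx /=.
by apply: lex_le_cat => //; apply: contra_neq ne => -[].
Qed.

End DbOrderTheory.

(** * Contexts *)

Section Contexts.
Context {X Omega : choiceType}.
Implicit Types (u v w x y p r : bword X Omega) (q : star_word X Omega).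

Fixpoint embed_letter (l : letter X Omega) : letter (option X) Omega :=
  match l with
  | Gen x => Gen (Some x)
  | Brk a v => Brk a (map embed_letter v)
  end.

(** Words without star, read in the alphabet extended by the star. *)
Definition embed u : bword (option X) Omega := map embed_letter u.

Lemma nstar_embed u : nstar (embed u) = 0%N.
Proof.
have nl l : nstar_letter (embed_letter l) = 0%N.
  elim/letter_nested_ind: l => // a v /=.
  by elim: v => //= l v IH [-> /IH].
by rewrite /nstar; elim: u => //= l u ->; rewrite nl.
Qed.

Lemma subst_embed w u : flatten (map (subst_letter w) (embed u)) = u.
Proof.
have sl l : subst_letter w (embed_letter l) = [:: l].
  elim/letter_nested_ind: l => // a v /= IHv; rewrite /brk; congr [:: Brk a _].
  by elim: v IHv => //= l v IH [-> /IH ->].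
by elim: u => //= l u {2}<-; rewrite sl.
Qed.

Definition StarWord (s : bword (option X) Omega) (n1 : nstar s == 1%N) :
  star_word X Omega := exist _ s n1.

Definition star : star_word X Omega := @StarWord [:: Gen None] isT.

Lemma subst_star u : subst star u = u.
Proof. exact: cats0. Qed.

Lemma nstar_around p q r : nstar (embed p ++ val q ++ embed r) == 1%N.
Proof.
have /eqP := valP q; rewrite /nstar !map_cat !sumn_cat => ->.
by move: (nstar_embed p) (nstar_embed r); rewrite /nstar => -> ->.
Qed.

Definition around p q r : star_word X Omega := StarWord (nstar_around p q r).

Lemma subst_around p q r u : subst (around p q r) u = (p * subst q u * r)%M.
Proof.
by rewrite /subst /= !map_cat !flatten_cat !subst_embed catA.
Qed.

Definition prepend p q := around p q [::].

Lemma subst_prepend p q u : subst (prepend p q) u = (p * subst q u)%M.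
Proof. by rewrite subst_around mulm1. Qed.

Definition append q r := around [::] q r.

Lemma subst_append q r u : subst (append q r) u = (subst q u * r)%M.
Proof. by rewrite subst_around mul1m. Qed.

Lemma nstar_bracket (a : Omega) q : nstar (brk a (val q)) == 1%N.
Proof. by have := valP q; rewrite /nstar /= addn0. Qed.

Definition bracket (a : Omega) q : star_word X Omega :=
  StarWord (nstar_bracket a q).

Lemma subst_bracket a q u : subst (bracket a q) u = brk a (subst q u).
Proof. by []. Qed.

Lemma subst_letter_starless (l : letter (option X) Omega) u v :
  nstar_letter l = 0%N -> subst_letter u l = subst_letter v l.
Proof.
elim/letter_nested_ind: l => [[x|]|a w /= IHw n0] //=; congr (brk a _).
elim: w IHw n0 => //= l w IH [IHl /IH IHw] /eqP.
by rewrite addn_eq0 => /andP[/eqP/IHl -> /eqP/IHw ->].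
Qed.

(** Without a star the substitution acts as a letter-to-letter map, so that
    breadths can be read off before it. *)
Lemma subst_starless (s : bword (option X) Omega) : nstar s = 0%N ->
  exists2 p, size p = size s & forall u, flatten (map (subst_letter u) s) = p.
Proof.
rewrite /nstar; elim: s => [|l s IH] /=; first by exists [::].
move/eqP; rewrite addn_eq0 => /andP[/eqP l0 /eqP/IH[p sp Ep]].
exists (subst_letter [::] l ++ p) => [|u].
  by rewrite size_cat sp; case: l l0 => [[]|].
by rewrite Ep (subst_letter_starless u [::] l0).
Qed.

(** The star is either a letter of q, or inside a bracket that is a letter of
    q.  The degree of q is the measure for induction on the nesting. *)
Lemma star_wordP q : exists p r,
  (forall u, subst q u = p ++ u ++ r)
  \/ exists a q', (degP (val q') < degP (val q))%N
                /\ forall u, subst q u = p ++ brk a (subst q' u) ++ r.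
Proof.
case: q => q n1; rewrite /subst /=.
suff [s [l [t [-> s0 t0 l1]]]] : exists s l t,
    [/\ q = s ++ l :: t, nstar s = 0%N, nstar t = 0%N & nstar_letter l == 1%N].
  have [[p _ Ep] [r _ Er]] := (subst_starless s0, subst_starless t0).
  exists p, r; case: l l1 => [[x|]|a w] //= l1; [left|right] => [u|].
    by rewrite map_cat flatten_cat Ep /= Er.
  exists a, (StarWord l1); split=> [/=|u].
    by rewrite /degP map_cat sumn_cat /=; lia.
  by rewrite map_cat flatten_cat Ep /= Er.
move: n1; rewrite /nstar; elim: q => [|l q IH] //= n1.
have [l0|l1] : nstar_letter l = 0%N \/ nstar_letter l = 1%N by lia.
  rewrite l0 add0n in n1; have [s [l' [t [-> s0 t0 l1]]]] := IH n1.
  by exists (l :: s), l', t; rewrite /= l0.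
exists [::], l, q; split=> //; last exact/eqP.
by move: n1; rewrite l1 => /eqP[].
Qed.

(** Words of breadth 2 leave no room: if the star is a letter of q then q is
    the star alone, and otherwise it is inside one of the two brackets. *)
Lemma subst_eq_brk_brk q m x y (a b : Omega) :
  size m = 2 -> subst q m = (brk a x * brk b y)%M ->
  [\/ forall u, subst q u = u,
      exists2 q', x = subst q' m
        & forall u, subst q u = (brk a (subst q' u) * brk b y)%M
    | exists2 q', y = subst q' m
        & forall u, subst q u = (brk a x * brk b (subst q' u))%M].
Proof.
move=> sm; have [p [r [Eq|[c [q' [_ Eq]]]]]] := star_wordP q; rewrite Eq => E.
  have /eqP := congr1 size E; rewrite !size_cat sm /= => /eqP szs.
  have [p0 r0] : p = [::] /\ r = [::] by split; apply/size0nil; lia.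
  by apply: Or31 => u; rewrite Eq p0 r0 cats0.
case: p E Eq => [|l [|l' p]] /=.
- by case=> -> <- -> Eq; apply: Or32; exists q'.
- by case=> -> -> <- -> Eq; apply: Or33; exists q'.
- by move/(congr1 size) => /=; rewrite size_cat /=; lia.
Qed.

End Contexts.

Section SubstMonotone.
Context {dX dO : Order.disp_t} {X : orderType dX} {Omega : orderType dO}.

Lemma db_lt_subst (q : star_word X Omega) (u v : bword X Omega) :
  weight_lt u v -> db_lt (subst q u) (subst q v).
Proof.
move=> uv; move: {2}_.+1 (ltnSn (degP (val q))) => n.
elim: n q => // n IH q; have [p [r [Eq|[a [q' [lt Eq]]]]]] := star_wordP q.
  by rewrite !Eq => _; apply/db_lt_weight/weight_lt_cat.
by rewrite !Eq => qn; apply/db_lt_brk/IH/(leq_trans lt).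
Qed.

End SubstMonotone.

(** * The defining elements and their leading words *)

Section MatchingRotaBaxter.
Context {k : comNzRingType} {dX dO : Order.disp_t}.
Context {X : orderType dX} {Omega : orderType dO}.
Variable lambda : Omega -> k.

Local Notation A := {malg k[bword X Omega]}.
Local Notation S := (@matching_rota_baxter_set k X Omega lambda).
Local Notation leading := (@leading k X Omega (@db_le dX dO X Omega)).
Local Notation trivial_modulo :=
  (@trivial_modulo k X Omega (@db_le dX dO X Omega) S).
Implicit Types (u v w x y z p r : bword X Omega) (q : star_word X Omega) (f h : A).
Implicit Types (a b c d : Omega) (phi : bword X Omega -> k).

Definition rb x a y b : A :=
  << (brk a x * brk b y)%M >> - << brk a (x * brk b y)%M >>
  - << brk b (brk a x * y)%M >> - lambda b *: << brk a (x * y)%M >>.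

Lemma mem_rb f : S f -> exists x a y b, f = rb x a y b.
Proof. by case=> x [y [a [b ->]]]; exists x, a, y, b. Qed.

(** The value at the element [rb x a y b] of the linear functional that maps
    each word w to phi w. *)
Definition rb_eval phi x a y b : k :=
  phi (brk a x * brk b y)%M - phi (brk a (x * brk b y)%M)
  - phi (brk b (brk a x * y)%M) - lambda b * phi (brk a (x * y)%M).

Definition coeff_at u w : k := (w == u)%:R.

Lemma mcoeff_rb x a y b u : (rb x a y b)@_u = rb_eval (coeff_at u) x a y b.
Proof. by rewrite /rb !mcoeffB mcoeffZ !mcoeffU1. Qed.

Lemma weight_rb x a y b :
  [/\ weight_lt (brk a (x * brk b y)%M) (brk a x * brk b y)%M,
      weight_lt (brk b (brk a x * y)%M) (brk a x * brk b y)%M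
    & weight_lt (brk a (x * y)%M) (brk a x * brk b y)%M].
Proof.
by rewrite /weight_lt !(breP_cat, degP_cat, degP_brk, breP_brk); split; lia.
Qed.

Lemma msupp_rb x a y b u : u \in msupp (rb x a y b) ->
  u = (brk a x * brk b y)%M \/ weight_lt u (brk a x * brk b y)%M.
Proof.
have [w1 w2 w3] := weight_rb x a y b.
rewrite -mcoeff_neq0 mcoeff_rb /rb_eval /coeff_at.
have [<- _|_] := eqVneq (brk a x * brk b y)%M u; first by left.
have [<- _|_] := eqVneq (brk a _) u; first by right.
have [<- _|_] := eqVneq (brk b _) u; first by right.
have [<- _|_] := eqVneq (brk a _) u; first by right.
by rewrite mulr0 !subr0 eqxx.
Qed.

Lemma mcoeff_leading_rb x a y b : (rb x a y b)@_(brk a x * brk b y)%M = 1.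
Proof.
have neq u v : weight_lt u v -> (u == v) = false.
  by move/db_lt_weight/andP => [/negPf].
have [w1 w2 w3] := weight_rb x a y b.
by rewrite mcoeff_rb /rb_eval /coeff_at eqxx !neq // mulr0 !subr0.
Qed.

Lemma mem_leading_rb x a y b : (brk a x * brk b y)%M \in msupp (rb x a y b).
Proof. by rewrite -mcoeff_neq0 mcoeff_leading_rb oner_neq0. Qed.

Lemma leading_rb x a y b : leading (rb x a y b) (brk a x * brk b y)%M.
Proof.
split=> [[c E]||u /msupp_rb[->|/db_lt_weight/andP[]//]].
- have := mcoeff_leading_rb x a y b; rewrite E mcoeffC mulr0n => /eqP.
  by rewrite eq_sym oner_eq0.
- exact: mem_leading_rb.
- exact: db_le_refl.
Qed.

(** Any other word of the support is smaller in weight than [x]_a [y]_b, which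
    is itself in the support. *)
Lemma leading_rb_eq x a y b w :
  leading (rb x a y b) w -> w = (brk a x * brk b y)%M.
Proof.
case=> _ /msupp_rb[//|lt] /(_ _ (mem_leading_rb x a y b)) /db_le_weight.
by rewrite lt.
Qed.

Lemma eq_lsubst q1 q2 h : subst q1 =1 subst q2 -> lsubst q1 h = lsubst q2 h.
Proof. by move=> E; apply: eq_bigr => v _; rewrite E. Qed.

Lemma malgZU (c : k) u : c *: << u >> = << c *g u >> :> A.
Proof. by apply/malgP => v; rewrite mcoeffZ !mcoeffU mulrnAr mulr1. Qed.

(** Placing an element in a context, or multiplying it by a word, amounts to
    composing the functional with that operation on words. *)
Lemma mcoeff_lsubst_rb q x a y b u :
  (lsubst q (rb x a y b))@_u = rb_eval (coeff_at u \o subst q) x a y b.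
Proof.
have lE h :
    lsubst q h = mmap (fun c : k => c%:MP) (fun u => << subst q u >> : A) h.
  by rewrite mmapE; apply: eq_bigr => v _; rewrite mul_malgC.
have lU (c : k) v : lsubst q << c *g v >> = c *: << subst q v >> :> A.
  by rewrite lE mmapU /= mul_malgC.
rewrite lE /rb malgZU !mmapB -!lE !lU !scale1r.
by rewrite !mcoeffB mcoeffZ !mcoeffU1.
Qed.

Lemma mcoeff_rbM x a y b v u :
  (rb x a y b * << v >>)@_u
  = rb_eval (fun w => coeff_at u (w * v)%M) x a y b.
Proof.
rewrite /rb malgZU !mulrBl !malgM_def !fgmulUU !mulr1.
by rewrite !mcoeffB !mcoeffU -[lambda b *+ _]mulr_natr.
Qed.

Lemma mcoeff_Mrb x a y b v u :
  (<< v >> * rb x a y b)@_u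
  = rb_eval (fun w => coeff_at u (v * w)%M) x a y b.
Proof.
rewrite /rb malgZU !mulrBr !malgM_def !fgmulUU !mul1r.
by rewrite !mcoeffB !mcoeffU -[lambda b *+ _]mulr_natr.
Qed.

(** * Combinations that are trivial modulo the set *)

Lemma trivial0 w : trivial_modulo w 0.
Proof.
exists 0, (fun=> 0), (fun=> star), (fun=> 0).
by split=> [[]//|]; rewrite big_ord0.
Qed.

Lemma trivialD w h1 h2 :
  trivial_modulo w h1 -> trivial_modulo w h2 -> trivial_modulo w (h1 + h2).
Proof.
case=> n1 [c1 [q1 [s1 [T1 ->]]]] [n2 [c2 [q2 [s2 [T2 ->]]]]].
pose glue T (f1 : 'I_n1 -> T) (f2 : 'I_n2 -> T) (i : 'I_(n1 + n2)) : T :=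
  match split i with inl j => f1 j | inr j => f2 j end.
exists (n1 + n2)%N, (glue _ c1 c2), (glue _ q1 q2), (glue _ s1 s2); split.
  by move=> i; rewrite /glue; case: (split i).
rewrite big_split_ord; apply: f_equal2; apply: eq_bigr => i _.
  by rewrite /glue (unsplitK (inl i)).
by rewrite /glue (unsplitK (inr i)).
Qed.

(** The terms of a trivial combination must have nonzero scalars, whereas
    here c may be a multiple of some lambda that vanishes; such a term is
    dropped. *)
Lemma trivial_rb w (c : k) q x a y b :
  db_lt (subst q (brk a x * brk b y)%M) w ->
  trivial_modulo w (c *: lsubst q (rb x a y b)).
Proof.
move=> lt; have [->|c0] := eqVneq c 0.
  by rewrite scale0r; apply: trivial0.
exists 1, (fun=> c), (fun=> q), (fun=> rb x a y b); split=> [_|].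
  split=> //; first by exists x, y, a, b.
  by exists (brk a x * brk b y)%M; [exact: leading_rb | exact: lt].
by rewrite big_ord1.
Qed.

(** The data of one term c *: q|_s with s = rb x a y b. *)
Record summand := Summand {
  scalar : k;
  context : star_word X Omega;
  arg1 : bword X Omega;
  op1 : Omega;
  arg2 : bword X Omega;
  op2 : Omega }.

Definition summand_lead t : bword X Omega :=
  subst (context t) (brk (op1 t) (arg1 t) * brk (op2 t) (arg2 t))%M.

Definition summand_eval phi t : k :=
  scalar t
  * rb_eval (phi \o subst (context t)) (arg1 t) (op1 t) (arg2 t) (op2 t).

(** A certificate of triviality is a list of terms with small leading words
    and an identity of scalars for each coefficient. *)
Lemma trivial_sum w h (ts : seq summand) :
  foldr (fun t Q => db_lt (summand_lead t) w /\ Q) True ts ->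
  (forall u, h@_u = foldr (fun t e => summand_eval (coeff_at u) t + e) 0 ts) ->
  trivial_modulo w h.
Proof.
elim: ts h => [|t ts IH] h /= => [_ E|[lt lts] E].
  have -> : h = 0 by apply/malgP => u; rewrite E mcoeff0.
  exact: trivial0.
pose g := scalar t *: lsubst (context t) (rb (arg1 t) (op1 t) (arg2 t) (op2 t)).
rewrite -(subrKC g h); apply: trivialD; first exact: trivial_rb.
apply: IH => // u.
by rewrite mcoeffB E mcoeffZ mcoeff_lsubst_rb addrAC subrr add0r.
Qed.

(** * The compositions *)

(** An intersection of two words of breadth 2 has breadth 3: one bracket is
    common. *)
Lemma brk_brk_overlap x y u v a b c d p r :
  (brk a x * brk b y * p)%M = (r * (brk c u * brk d v))%M ->
  (2 < size (brk a x * brk b y * p)%M < 4)%N ->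
  [/\ p = brk d v, r = brk a x, b = c & y = u].
Proof.
case: p r => [|l [|l' p]] [|l1 [|l2 r]] //=.
- by case=> <- -> -> -> _.
- by move/(congr1 size); rewrite /= size_cat /=; lia.
Qed.

(** The first six terms rewrite the products of two brackets that the
    composition contains once the leading word is cancelled; the last two are
    what remains. *)
Lemma intersection_trivial x a y b z c :
  trivial_modulo (brk a x * brk b y * brk c z)%M
    (rb x a y b * << brk c z >> - << brk a x >> * rb y b z c).
Proof.
apply: (@trivial_sum _ _ [::
  Summand (-1) star (x * brk b y)%M a z c;
  Summand (-1) star (brk a x * y)%M b z c;
  Summand (- lambda b) star (x * y)%M a z c;
  Summand 1 star x a (y * brk c z)%M b;
  Summand 1 star x a (brk b y * z)%M c;
  Summand (lambda c) star x a (y * z)%M b;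
  Summand (-1) (bracket a (prepend x star)) y b z c;
  Summand 1 (bracket c (append star z)) x a y b ]) => [|u].
  rewrite /summand_lead /= !subst_bracket subst_prepend subst_append !subst_star.
  do !split => //; apply: db_lt_weight; rewrite /weight_lt;
    rewrite !(breP_cat, degP_cat, degP_brk, breP_brk); lia.
rewrite mcoeffB mcoeff_rbM mcoeff_Mrb /summand_eval /rb_eval /=.
move: (coeff_at u) => phi.
rewrite !subst_bracket !subst_prepend !subst_append !subst_star ?mulmA.
ring.
Qed.

(** Let g = m - sum of c_i m_i, with m its leading word.  The first three terms
    replace m by the m_i in the first element; subtracting the context
    [q|_g]_a [y]_b leaves the three non-leading words of that element with g in
    place of m, which are the last three terms. *)
Lemma including_left_trivial q u c v d y a b :
  trivial_modulo (brk a (subst q (brk c u * brk d v)%M) * brk b y)%M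
    (rb (subst q (brk c u * brk d v)%M) a y b
     - lsubst (append (bracket a q) (brk b y)) (rb u c v d)).
Proof.
have [w1 w2 w3] := weight_rb u c v d.
apply: (@trivial_sum _ _ [::
  Summand 1 star (subst q (brk c (u * brk d v)%M)) a y b;
  Summand 1 star (subst q (brk d (brk c u * v)%M)) a y b;
  Summand (lambda d) star (subst q (brk c (u * v)%M)) a y b;
  Summand (-1) (bracket a (append q (brk b y))) u c v d;
  Summand (-1) (bracket b (append (bracket a q) y)) u c v d;
  Summand (- lambda b) (bracket a (append q y)) u c v d ]) => [|r].
  rewrite /summand_lead /= !(subst_bracket, subst_append) !subst_star.
  do 3![split; first by apply: (@db_lt_brk _ _ _ _ _ [::]); apply: db_lt_subst].
  by do !split => //; apply: db_lt_weight; rewrite /weight_lt;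
    rewrite !(breP_cat, degP_cat, degP_brk, breP_brk); lia.
rewrite mcoeffB mcoeff_rb mcoeff_lsubst_rb /summand_eval /rb_eval /=.
move: (coeff_at r) => phi.
rewrite !(subst_bracket, subst_append) !subst_star ?mulmA.
ring.
Qed.

Lemma including_right_trivial q u c v d x a b :
  trivial_modulo (brk a x * brk b (subst q (brk c u * brk d v)%M))%M
    (rb x a (subst q (brk c u * brk d v)%M) b
     - lsubst (prepend (brk a x) (bracket b q)) (rb u c v d)).
Proof.
have [w1 w2 w3] := weight_rb u c v d.
apply: (@trivial_sum _ _ [::
  Summand 1 star x a (subst q (brk c (u * brk d v)%M)) b;
  Summand 1 star x a (subst q (brk d (brk c u * v)%M)) b;
  Summand (lambda d) star x a (subst q (brk c (u * v)%M)) b;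
  Summand (-1) (bracket a (prepend x (bracket b q))) u c v d;
  Summand (-1) (bracket b (prepend (brk a x) q)) u c v d;
  Summand (- lambda b) (bracket a (prepend x q)) u c v d ]) => [|r].
  rewrite /summand_lead /= !(subst_bracket, subst_prepend) !subst_star.
  do 3![split; first by rewrite -[brk b _]cats0 -[X in db_lt _ (_ * X)%M]cats0;
          apply: db_lt_brk; apply: db_lt_subst].
  by do !split => //; apply: db_lt_weight; rewrite /weight_lt;
    rewrite !(breP_cat, degP_cat, degP_brk, breP_brk); lia.
rewrite mcoeffB mcoeff_rb mcoeff_lsubst_rb /summand_eval /rb_eval /=.
move: (coeff_at r) => phi.
rewrite !(subst_bracket, subst_prepend) !subst_star ?mulmA.
ring.
Qed.

End MatchingRotaBaxter.

Theorem theorem3p5 (k : comNzRingType) (dX dO : Order.disp_t)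
    (X : orderType dX) (Omega : orderType dO)
    (wfX : well_founded (fun x y : X => (x < y)%O))
    (wfOmega : well_founded (fun a b : Omega => (a < b)%O))
    (Omega_nonempty : inhabited Omega)
    (lambda : Omega -> k) :
  groebner_shirshov_basis (@db_le dX dO X Omega)
    (@matching_rota_baxter_set k X Omega lambda).
Proof.
split=> [_ /mem_rb[x [a [y [b ->]]]]|].
  by exists (brk a x * brk b y)%M; [apply: leading_rb | apply: mcoeff_leading_rb].
move=> _ _ /mem_rb[x [a [y [b ->]]]] /mem_rb[u [c [v [d ->]]]] neq w h [].
  case=> _ [_ [p [r [/leading_rb_eq-> /leading_rb_eq-> [-> E] sz ->]]]].
  have [-> -> <- <-] := brk_brk_overlap E sz.
  exact: intersection_trivial.
case=> _ [_ [q [/leading_rb_eq-> /leading_rb_eq-> [-> E] ->]]].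
have [Eq|[q' -> Eq]|[q' -> Eq]] :=
  @subst_eq_brk_brk _ _ q (brk c u * brk d v)%M _ _ _ _ erefl (esym E).
- by case: neq; move: E; rewrite Eq => -[-> -> -> ->].
- rewrite (eq_lsubst (q2 := append (bracket a q') (brk b y))) => [|p].
    exact: including_left_trivial.
  by rewrite Eq subst_append.
- rewrite (eq_lsubst (q2 := prepend (brk a x) (bracket b q'))) => [|p].
    exact: including_right_trivial.
  by rewrite Eq subst_prepend.
Qed.
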